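(* Let $X$ be a Banach space over $\mathbb{K}\in\{\mathbb{R},\mathbb{C}\}$ and let $\tau$ be an admissible topology on $X$. Let $\{x_n\}_{n=0}^\infty\subseteq X$ be a sequence such that the formal series $\sum_{n=0}^\infty x_n$ fails to be unconditionally summable in the norm topology. Then: (i) there exist $\epsilon_0,\epsilon_1,\epsilon_2,\dots\in\{-1,+1\}$ such that the sequence $\{\Sigma_N\}_{N=0}^\infty$ defined by $\Sigma_N=\sum_{n=0}^N\epsilon_n x_n$ does not $\tau$-converge as $N\to\infty$ to any element of $X$; and (ii) there exist $\chi_0,\chi_1,\chi_2,\dots\in\{0,1\}$ such that the sequence $\{S_N\}_{N=0}^\infty$ defined by $S_N=\sum_{n=0}^N\chi_n x_n$ does not $\tau$-converge as $N\to\infty$ to any element of $X$. In particular, (i) and (ii) hold if $\sum_{n=0}^\infty x_n$ is not summable in the norm topology (i.e. if its partial sums do not converge in norm).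
   Context: A topology $\tau$ on a Banach space $X$ is called admissible if (1) it is a Hausdorff locally convex topological vector space topology on $X$, identical to or weaker than the norm topology, under which the norm-closed unit ball $\mathbb{B}=\{x\in X:\|x\|\le 1\}$ is $\tau$-closed; and (2) if $X$ is not separable, then $\tau$ is at least as strong as the weak topology of $X$. A formal series is unconditionally summable in the norm topology if every rearrangement of it converges in norm. *)

(* Defs.v *)
From HB Require Import structures.
From mathcomp Require Import all_boot all_order all_algebra.
From mathcomp Require Import all_classical all_reals all_analysis.
From mathcomp Require Export complex.

Set Implicit Arguments.
Unset Strict Implicit.
Unset Printing Implicit Defensive.

Import Order.TTheory GRing.Theory Num.Theory.
Import numFieldNormedType.Exports.

Local Open Scope classical_set_scope.
Local Open Scope ring_scope.

(* The factory [isOpenTopological] is a record of open sets: a family of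
   subsets of [X] that contains [setT] and is stable under binary
   intersections and arbitrary unions. *)
Definition topology_on (X : choiceType) : Type :=
  isOpenTopological.axioms_ X (Choice.class X) (Choice.class X).

(* The module [X] with the topology [tau] in place of any topology already
   attached to [X]. *)
Definition with_topology (K : numFieldType) (X : lmodType K)
  (tau : topology_on X) : Type := X.

HB.instance Definition _ (K : numFieldType) (X : lmodType K)
  (tau : topology_on X) := GRing.Lmodule.on (with_topology tau).
HB.instance Definition _ (K : numFieldType) (X : lmodType K)
    (tau : topology_on X) :=
  isOpenTopological.Build (with_topology tau) (isOpenTopological.opT tau)
    (@isOpenTopological.opI _ _ _ tau)
    (@isOpenTopological.op_bigU _ _ _ tau).

Definition separable (T : topologicalType) :=
  exists2 D : set T, countable D & dense D.

(* The coarsest topology on [X] for which every norm-continuous linear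
   functional is continuous. *)
Definition weak_topology (K : numFieldType) (X : normedModType K) : Type :=
  sup_topology (fun f : {f : {scalar X} | continuous (f : X -> K)} =>
    Topological.on (initial_topology (sval f : X -> K))).

HB.instance Definition _ (K : numFieldType) (X : normedModType K) :=
  Topological.on (weak_topology X).

(* The last three clauses are the fields of [PreTopologicalLmod_isTvs], the
   library's interface for locally convex topological vector spaces. *)
Definition hausdorff_lctvs (K : numFieldType) (E : preTopologicalLmodType K) :=
  [/\ hausdorff_space E,
      continuous (fun z : E * E => z.1 + z.2),
      continuous (fun z : K^o * E => z.1 *: z.2) &
      exists2 B : set_system E, (forall b, b \in B -> convex_set b) & basis B].

Definition admissible (K : numFieldType) (X : normedModType K)
    (tau : topology_on X) :=
  [/\ hausdorff_lctvs (with_topology tau),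
      forall U : set X, open (U : set (with_topology tau)) -> open U,
      closed ([set x : X | `|x| <= 1] : set (with_topology tau)) &
      ~ separable X -> forall U : set X,
        open (U : set (weak_topology X)) ->
        open (U : set (with_topology tau))].

Definition unconditionally_summable (K : numFieldType) (X : normedModType K)
    (x : X ^nat) :=
  forall s : nat -> nat, bijective s -> cvgn (series (x \o s)).

(* Main.v *)
Require Import Defs.
From HB Require Import structures.
From mathcomp Require Import all_boot all_order all_algebra.
From mathcomp Require Import all_classical all_reals all_analysis.
From mathcomp Require Import ring lra.

(** Both parts say that if all signed series, or all subseries, converge for an
    admissible topology, then the series is unconditionally summable in norm:
    an Orlicz-Pettis theorem ([orlicz_pettis]). Signs reduce to subseries
    because an indicator is the average of a sign sequence and the constant 1.

    Suppose all subseries converge for tau but unconditional summability fails.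
    By completeness some r > 0 admits successive disjoint blocks of indices
    whose block sums y_k all have norm larger than r
    ([not_unconditional_blocks]), and every subseries of the y_k is again
    tau-summable, with sums z(chi) indexed by the subsets chi of nat
    ([block_subseries]). Choose real-linear functionals g_k dominated by the
    norm, with r <= g_k(y_k), and sequentially tau-continuous, so that
    g_k(z(chi)) is the sum of the g_k(y_j) over j in chi. A gliding hump shows
    that this is impossible as soon as all z(chi) lie in the closed span of one
    sequence d ([gliding_hump]): a subsequence of the g_k converges on d, hence
    on every z(chi), while a subset chi picking every other index of a sparse
    subsequence makes the values at z(chi) jump by about r infinitely often.

    The functionals come from the Hahn-Banach theorem, used only in the form of
    [norming_functional]. If X is separable, d is dense, and since the unit ball
    is tau-closed and tau is locally convex, y_k has a convex tau-neighbourhood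
    missing the ball of radius r; a functional separating them is
    tau-continuous. If X is not separable, tau refines the weak topology, so any
    norm-bounded functional is tau-continuous ([bounded_seq_continuous]); here d
    is the sequence y itself, and z(chi) lies in its closed span because it is a
    weak limit of elements of the span.

    Real and complex scalars are treated together: everything happens in the
    real vector space underlying X, and [real_scalars] lists the few properties
    of the scalar field on which this depends. *)

Set Implicit Arguments.
Unset Strict Implicit.
Unset Printing Implicit Defensive.

Import Order.TTheory GRing.Theory Num.Theory.
Import numFieldNormedType.Exports.

Local Open Scope classical_set_scope.
Local Open Scope ring_scope.

(** * Sublinear functionals and the Hahn-Banach theorem *)

(** Homogeneity is only asked as an inequality for positive scalars; applied to
    the inverse scalar it gives back the equality ([sublinearZ]). *)
Definition sublinear (R : realType) (E : lmodType R) (p : E -> R) :=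
  (forall x y, p (x + y) <= p x + p y) /\
  (forall a x, 0 < a -> p (a *: x) <= a * p x).

Section Sublinear.
Variables (R : realType) (E : lmodType R).
Implicit Types (p q : E -> R) (x y : E).

Lemma sublinearZ p a x : sublinear p -> 0 < a -> p (a *: x) = a * p x.
Proof.
move=> [_ pZ] a0; apply/eqP; rewrite eq_le pZ//= -ler_pdivlMl//.
by rewrite -{1}[x](scalerK (lt0r_neq0 a0)) pZ// invr_gt0.
Qed.

Lemma sublinear0 p : sublinear p -> p 0 = 0.
Proof.
move=> sp; have := @sublinearZ p 2 0 sp (ltr0n _ 2).
by rewrite scaler0; lra.
Qed.

Lemma sublinear_geN p x : sublinear p -> - p (- x) <= p x.
Proof.
move=> sp; have := sp.1 x (- x).
by rewrite subrr sublinear0//; lra.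
Qed.

(** The sets [V x] play the role of upper bounds for the functional at [x]; this
    one criterion covers infima along a ray, infima of chains of functionals,
    and Minkowski gauges. *)
Lemma inf_sublinear (V : E -> set R) :
  (forall x, has_inf (V x)) ->
  (forall x y r s, V x r -> V y s -> exists2 t, V (x + y) t & t <= r + s) ->
  (forall a x r, 0 < a -> V x r -> exists2 t, V (a *: x) t & t <= a * r) ->
  sublinear (fun x => inf (V x)).
Proof.
move=> iV VD VZ; split=> [x y|a x a0].
  rewrite -lerBlDr; apply: lb_le_inf; first by case: (iV x).
  move=> r Vr; rewrite lerBlDr -lerBlDl.
  apply: lb_le_inf; first by case: (iV y).
  move=> s Vs; rewrite lerBlDl.
  have [t Vt trs] := VD _ _ _ _ Vr Vs.
  by apply: le_trans trs; apply: ge_inf => //; case: (iV (x + y)).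
rewrite -ler_pdivrMl//; apply: lb_le_inf; first by case: (iV x).
move=> r Vr; rewrite ler_pdivrMl//.
have [t Vt tr] := VZ _ _ _ a0 Vr.
by apply: le_trans tr; apply: ge_inf => //; case: (iV (a *: x)).
Qed.

(** The functional q(x) = inf over t >= 0 of p(x + t y) - t p(y) is the largest
    sublinear one below p that is linear on the line through y with value p(y)
    at y. It stays finite because p(x + t y) >= t p(y) - p(-x). *)
Lemma sublinear_along p y : sublinear p ->
  exists q, [/\ sublinear q, forall x, q x <= p x & q (- y) <= - p y].
Proof.
move=> sp.
pose V x := [set p (x + t *: y) - t * p y | t in [set t | 0 <= t]].
have hl x : lbound (V x) (- p (- x)).
  move=> _ [t /= t0 <-].
  have pty : t * p y = p (t *: y).
    move: t0; rewrite le_eqVlt => /predU1P[<-|t0]; last by rewrite sublinearZ.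
    by rewrite scale0r mul0r sublinear0.
  have := sp.1 (x + t *: y) (- x).
  by rewrite addrAC subrr add0r pty; lra.
have iV x : has_inf (V x).
  split; last by exists (- p (- x)).
  by exists (p (x + 0 *: y) - 0 * p y); exists 0 => /=.
have qle x t : 0 <= t -> inf (V x) <= p (x + t *: y) - t * p y.
  by move=> t0; apply: ge_inf; [case: (iV x)|exists t].
exists (fun x => inf (V x)); split.
- apply: inf_sublinear => //.
  + move=> x x' _ _ [t /= t0 <-] [s /= s0 <-].
    exists (p (x + x' + (t + s) *: y) - (t + s) * p y).
      by exists (t + s) => //=; exact: addr_ge0.
    rewrite scalerDl addrACA.
    by have := sp.1 (x + t *: y) (x' + s *: y); lra.
  + move=> a x _ a0 [t /= t0 <-].
    exists (p (a *: x + (a * t) *: y) - a * t * p y).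
      by exists (a * t) => //=; rewrite mulr_ge0// ltW.
    by rewrite -scalerA -scalerDr mulrBr mulrA lerD2r; exact: sp.2.
- by move=> x; have := qle x 0 (lexx _); rewrite scale0r addr0 mul0r subr0.
- by have := qle (- y) 1 ler01; rewrite scale1r addNr sublinear0// mul1r sub0r.
Qed.

(** Zorn's lemma. A chain of sublinear functionals below p is bounded from below
    at x by - p(-x), so its pointwise infimum is finite. *)
Lemma sublinear_minimal p : sublinear p ->
  exists q, [/\ sublinear q, forall x, q x <= p x &
    forall r, sublinear r -> (forall x, r x <= q x) -> r = q].
Proof.
move=> sp.
pose T := {q : E -> R | sublinear q /\ forall x, q x <= p x}.
pose t0 : T := exist _ p (conj sp (fun x => lexx (p x))).
have [||A Atot|[q [sq qp]] qmin] :=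
    @ZL_preorder T t0 (fun q r : T => `[< forall x, sval r x <= sval q x >]).
- by move=> t; apply/asboolP => x.
- move=> r s t /asboolP rs /asboolP st; apply/asboolP => x.
  exact: le_trans (rs x).
- have [->|/set0P[a Aa]] := eqVneq A set0; first by exists t0.
  pose V x := [set sval q x | q in A].
  have iV x : has_inf (V x).
    split; first by exists (sval a x); exists a.
    exists (- p (- x)) => _ [[q [sq qp]] _ <-] /=.
    by have := sublinear_geN x sq; have := qp (- x); lra.
  have Vle (q : T) x : A q -> inf (V x) <= sval q x.
    by move=> Aq; apply: ge_inf; [case: (iV x)|exists q].
  have sV : sublinear (fun x => inf (V x)).
    apply: inf_sublinear => //.
    + move=> x y _ _ [q Aq <-] [r Ar <-].
      have [/asboolP|/asboolP] := Atot _ _ Aq Ar => h.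
      * exists (sval r (x + y)); first by exists r.
        by apply: le_trans ((svalP r).1.1 _ _) _; rewrite lerD2r.
      * exists (sval q (x + y)); first by exists q.
        by apply: le_trans ((svalP q).1.1 _ _) _; rewrite lerD2l.
    + move=> b x _ b0 [q Aq <-].
      exists (sval q (b *: x)); first by exists q.
      exact: (svalP q).1.2.
  have Vp x : inf (V x) <= p x := le_trans (Vle _ x Aa) ((svalP a).2 x).
  pose t : T :=
    exist (fun q => sublinear q /\ forall x, q x <= p x) _ (conj sV Vp).
  exists t => s As; apply/asboolP => x.
  exact: Vle.
exists q; split=> // r sr rq.
have rp x : r x <= p x := le_trans (rq x) (qp x).
pose t : T := exist _ r (conj sr rp).
have /asboolP/= qr := qmin t (introT (asboolP _) rq).
by apply/funext => x; apply/eqP; rewrite eq_le rq qr.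
Qed.

Lemma sublinear_odd_linear p : sublinear p -> (forall x, p (- x) = - p x) ->
  exists f : {scalar E}, forall x, f x = p x.
Proof.
move=> sp pN.
have pD x y : p (x + y) = p x + p y.
  apply/eqP; rewrite eq_le sp.1/=.
  have := sp.1 (x + y) (- y); rewrite addrK pN; lra.
have pZ a x : p (a *: x) = a * p x.
  have [a0|a0|->] := ltgtP a 0; last by rewrite scale0r mul0r sublinear0.
    by rewrite -[a]opprK scaleNr pN sublinearZ ?mulNr// oppr_gt0.
  exact: sublinearZ.
have lp : linear_for *%R p by move=> a x y; rewrite pD pZ.
by exists (HB.pack_for {scalar E} p (GRing.isLinear.Build R E R *%R p lp)).
Qed.

(** Minimal sublinear functionals are linear: minimality forces q to agree with
    its modification along any y, which is odd at y. Starting from p modified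
    along y, a minimal functional below it keeps the value of p at y. Working
    with minimal functionals on the whole space avoids partially defined linear
    maps. *)
Theorem hahn_banach p y : sublinear p ->
  exists f : {scalar E}, (forall x, f x <= p x) /\ p y <= f y.
Proof.
move=> sp; have [p1 [sp1 p1p p1y]] := sublinear_along y sp.
have [q [sq qp1 qmin]] := sublinear_minimal sp1.
have [|f fq] := sublinear_odd_linear sq.
  move=> x; have [r [sr rq rx]] := sublinear_along x sq.
  have rE := qmin r sr rq; rewrite rE in rx.
  by apply/eqP; rewrite eq_le rx/= lerNl sublinear_geN.
exists f; split=> [x|]; first by rewrite fq (le_trans (qp1 x)).
by have := qp1 (- y); have := fq (- y); rewrite raddfN; lra.
Qed.

(** Hahn-Banach for the Minkowski gauge of [C]. *)
Theorem convex_separation (C : set E) y :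
  (forall u v a b, 0 <= a -> 0 <= b -> a + b = 1 ->
    C u -> C v -> C (a *: u + b *: v)) ->
  (forall x, exists2 t, 0 < t & C (t *: x)) ->
  ~ C y ->
  exists f : {scalar E}, (forall x, C x -> f x <= 1) /\ 1 <= f y.
Proof.
move=> Cc Ca Cy.
have C0 : C 0 by have [t _] := Ca 0; rewrite scaler0.
pose V x := [set t | 0 < t /\ C (t^-1 *: x)].
have iV x : has_inf (V x).
  split; last by exists 0 => t [/ltW].
  by have [t t0 Ct] := Ca x; exists t^-1; split; rewrite ?invr_gt0// invrK.
have sV : sublinear (fun x => inf (V x)).
  apply: inf_sublinear => //.
  - move=> x z r s [r0 Cr] [s0 Cs]; exists (r + s) => //.
    have rs0 : 0 < r + s by exact: addr_gt0.
    split=> //.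
    have -> : (r + s)^-1 *: (x + z) =
        (r / (r + s)) *: (r^-1 *: x) + (s / (r + s)) *: (s^-1 *: z).
      by rewrite scalerDr !scalerA; congr (_ *: _ + _ *: _); field;
        rewrite !lt0r_neq0.
    by apply: Cc => //; rewrite ?divr_ge0 ?ltW// -mulrDl divff// lt0r_neq0.
  - move=> a x r a0 [r0 Cr]; exists (a * r) => //.
    split; first exact: mulr_gt0.
    by rewrite invfM mulrC scalerA -mulrA mulVf ?mulr1// lt0r_neq0.
have [f [fV fy]] := hahn_banach y sV.
exists f; split=> [x Cx|].
  apply: le_trans (fV x) _; apply: ge_inf; first by case: (iV x).
  by split=> //; rewrite invr1 scale1r.
apply: le_trans fy; apply: lb_le_inf; first by case: (iV y).
move=> t [t0 Ct]; rewrite leNgt; apply/negP => t1; apply: Cy.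
have := Cc _ _ t (1 - t) (ltW t0) _ _ Ct C0.
rewrite scaler0 addr0 scalerA divff ?scale1r ?lt0r_neq0//; apply; lra.
Qed.

End Sublinear.

(** * The gliding hump *)

(** One subset of nat realises a whole subfamily of blocks, so that every
    subseries of a series of blocks is a subseries of the original series. *)
Lemma block_subseries (b : nat -> nat) (P : nat -> nat -> bool)
    (e : nat -> bool) : (forall k, b k < b k.+1)%N ->
  exists chi : nat -> bool, forall (V : nmodType) (a : nat -> V) M,
    \sum_(0 <= i < b M) a i *+ chi i =
    \sum_(0 <= k < M) (\sum_(b k <= i < b k.+1 | P k i) a i) *+ e k.
Proof.
move=> bS.
have blt : {homo b : i j / (i < j)%N}.
  by apply: homo_ltn => //; exact: ltn_trans.
have ble := leq_mono blt.
pose chi i := `[< exists k, [/\ (b k <= i < b k.+1)%N, e k & P k i] >].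
exists chi => V a; elim=> [|M IH].
  rewrite [RHS]big_geq// big_nat big1// => i /= ib0.
  suff -> : chi i = false by [].
  apply/asboolP => -[k [/andP[bki _] _ _]].
  by have := leq_ltn_trans bki ib0; rewrite ltnNge ble.
rewrite [RHS]big_nat_recr//= -IH (big_cat_nat (n := b M))//=; last exact: ltnW.
congr (_ + _); rewrite -sumrMnl [RHS]big_mkcond/=.
apply: eq_big_nat => i /andP[bMi ibM].
suff -> : chi i = e M && P M i by case: (P M i); rewrite ?andbT ?andbF.
apply/asboolP/andP => [[k [/andP[bki ibk] ek Pki]]|[eM PMi]]; last first.
  by exists M; split=> //; rewrite bMi.
have [kM|Mk|<-//] := ltngtP k M.
  have : (b k.+1 <= b M)%N by rewrite ble.
  by move=> /(leq_trans ibk)/leq_trans/(_ bMi); rewrite ltnn.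
have : (b M.+1 <= b k)%N by rewrite ble.
by move=> /(leq_trans ibM)/leq_trans/(_ bki); rewrite ltnn.
Qed.

Lemma history_choice (Q : seq nat -> nat -> Prop) :
  (forall s, exists k, Q s k) ->
  exists kap : nat -> nat, forall m, Q (mkseq kap m) (kap m).
Proof.
move=> /choice[c Qc].
pose hist m := iter m (fun s => rcons s (c s)) [::].
exists (c \o hist) => m.
suff -> : mkseq (c \o hist) m = hist m by exact: Qc.
by elim: m => // m IH; rewrite mkseqS IH.
Qed.

Lemma near_all_mem (T : Type) (I : eqType) (F : set_system T) {FF : Filter F}
    (P : I -> T -> Prop) (s : seq I) :
  (forall i, i \in s -> \forall x \near F, P i x) ->
  \forall x \near F, forall i, i \in s -> P i x.
Proof.
elim: s => [_|j s IH Ps]; first by apply: nearW => x i; rewrite in_nil.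
have Pj := Ps j (mem_head _ _).
have /IH Ps' : forall i, i \in s -> \forall x \near F, P i x.
  by move=> i si; apply: Ps; rewrite inE si orbT.
near=> x => i; rewrite inE => /predU1P[->|].
  by near: x.
by move: i; near: x.
Unshelve. all: by end_near. Qed.

Lemma ultrafilter_bounded_cvg (R : realType) (T : Type) (U : set_system T)
    (f : T -> R) (M : R) :
  UltraFilter U -> (forall t, `|f t| <= M) -> exists l : R, f @ U --> l.
Proof.
move=> UU fM.
have fUU : UltraFilter (f @ U).
  split=> [|G GG fUG]; first exact: fmap_proper_filter.
  rewrite eqEsubset; split=> // A GA.
  have [//|UC] := in_ultra_setVsetC (f @^-1` A) UU.
  have GC : G (~` A) by exact: fUG.
  have /filter_ex[x [] //] : G (A `&` ~` A) by exact: filterI.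
have := @segment_compact R (- M) M.
rewrite compact_ultra => /(_ _ fUU)[|l [_ fl]]; last by exists l.
by apply: nearW => t /=; rewrite in_itv/= -ler_norml.
Qed.

(** [a] is one row of the hump matrix: left of the diagonal it has almost
    reached the limits [h] of the columns, right of it it is negligible. Hence
    the sum of the row over a subset is determined, within [3 * eps], by the
    limits [h] before the diagonal and by the diagonal entry. *)
Lemma row_sum_approx (R : realType) (a : nat -> R) (h : nat -> R)
    (e : nat -> bool) (F eps : R) (m : nat) : 0 < eps ->
  (forall j, (j < m)%N -> `|a j - h j| <= eps / m%:R) ->
  (forall j, (m < j)%N -> `|a j| <= eps / 2 ^+ j) ->
  (exists2 n, (m < n)%N & `|F - \sum_(0 <= j < n) a j *+ e j| < eps) ->
  `|F - (\sum_(0 <= j < m) h j *+ e j + a m *+ e m)| <= 3 * eps.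
Proof.
move=> e0 head tail [n mn].
rewrite (big_cat_nat (n := m))//=; last exact: ltnW.
rewrite (big_ltn mn).
set A := \sum_(0 <= j < m) a j *+ e j; set B := \sum_(m.+1 <= j < n) _.
set H := \sum_(0 <= j < m) _.
have AH : `|A - H| <= eps.
  rewrite -sumrB; apply: le_trans (ler_norm_sum _ _ _) _.
  have [->|m0] := posnP m; first by rewrite big_geq// ltW.
  apply: (@le_trans _ _ (\sum_(0 <= j < m) eps / m%:R)).
    apply: ler_sum_nat => j /= jm.
    by case: (e j); [exact: head|rewrite subrr normr0 divr_ge0// ltW].
  by rewrite sumr_const_nat subn0 -[_ *+ m](mulr_natr (eps / _)) divfK//
    pnatr_eq0 -lt0n.
have geo k :
    \sum_(m.+1 <= j < m.+1 + k) (2 ^+ j)^-1 <= 1 - (2 ^+ (m + k))^-1 :> R.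
  elim: k => [|k IH].
    by rewrite big_geq ?addn0// subr_ge0 invf_le1 ?exprn_gt0//
      exprn_ege1// ler1n.
  rewrite addnS big_nat_recr ?leq_addr//= addnS addSn.
  apply: le_trans (lerD IH (lexx _)) _.
  rewrite !exprS invfM; lra.
have Be : `|B| <= eps.
  apply: le_trans (ler_norm_sum _ _ _) _.
  apply: (@le_trans _ _ (\sum_(m.+1 <= j < n) eps / 2 ^+ j)).
    apply: ler_sum_nat => j /andP[mj _].
    by case: (e j); [exact: tail|rewrite normr0 divr_ge0// ltW// exprn_gt0].
  rewrite -mulr_sumr ger_pMr// -(subnKC mn).
  by apply: le_trans (geo _) _; rewrite gerBl invr_ge0 exprn_ge0.
move: AH Be; rewrite !ler_norml ltr_norml; lra.
Qed.

(** Along an ultrafilter [f k x] has a limit [h x] for every [x]; this provides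
    the limits that a sparse sequence of indices [kap] is made to approach, both
    on the columns [y (kap j)] and on the vectors [d i]. Summing over the odd
    terms of the subsequence, the rows of index [m] (even) and [m + 1] see the
    same initial part, but only the second one sees its diagonal entry, which is
    at least [delta]; yet both rows evaluate functionals at the same point,
    where they converge. *)
Theorem gliding_hump (R : realType) (E : lmodType R) (N : E -> R)
    (f : nat -> {scalar E}) (d y : nat -> E) (z : (nat -> bool) -> E)
    (delta : R) :
  (forall k x, `|f k x| <= N x) ->
  (forall (chi : nat -> bool) k,
    (fun n => \sum_(0 <= j < n) f k (y j) *+ chi j) @ \oo --> f k (z chi)) ->
  (forall chi eta, 0 < eta ->
    exists n (c : nat -> R), N (z chi - \sum_(0 <= i < n) c i *: d i) < eta) ->
  0 < delta -> ~ forall k, delta <= f k (y k).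
Proof.
move=> fN fz zd d0 fy.
(* In all, the estimates below lose ten times [eps]. *)
pose eps := delta / 16; have e0 : 0 < eps by rewrite divr_gt0.
have [U [UU ooU]] := @ultraFilterLemma nat \oo _.
have fU x : exists l : R, (fun k => f k x) @ U --> l.
  by apply: (ultrafilter_bounded_cvg UU) => k; exact: fN.
have [h fh] := choice fU.
have fy0 j : (fun k => f j (y k)) @ \oo --> (0 : R).
  apply: cvg_series_cvg_0; apply/cvg_ex; exists (f j (z (fun=> true))).
  exact: fz (fun=> true) j.
have [|kap kapQ] := @history_choice (fun s k => forall m, m = size s ->
  [/\ forall j, j \in s -> (j < k)%N,
      forall j, j \in s -> `|f k (y j) - h (y j)| <= eps / m%:R,
      forall j, j \in s -> `|f j (y k)| <= eps / 2 ^+ m &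
      forall i, i \in iota 0 m -> `|f k (d i) - h (d i)| < m.+1%:R^-1]).
  move=> s; apply: (@filter_ex _ U).
  have e1 j : j \in s -> 0 < eps / (size s)%:R.
    by case: s => // i s _; rewrite divr_gt0// ltr0n.
  have H1 : \forall k \near U, forall j, j \in s -> (j < k)%N.
    by apply: near_all_mem => j _; apply: ooU; exact: nbhs_infty_gt.
  have H2 : \forall k \near U, forall j, j \in s ->
      `|f k (y j) - h (y j)| <= eps / (size s)%:R.
    apply: near_all_mem => j js.
    apply: filterS ((cvgrPdist_le _ _).1 (fh (y j)) _ (e1 _ js)).
    by move=> k; rewrite distrC.
  have H3 : \forall k \near U, forall j, j \in s ->
      `|f j (y k)| <= eps / 2 ^+ size s.
    apply: near_all_mem => j _; apply: ooU.
    have es : 0 < eps / 2 ^+ size s by rewrite divr_gt0// exprn_gt0.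
    apply: filterS ((cvgrPdist_le _ _).1 (fy0 j) _ es) => k.
    by rewrite sub0r normrN.
  have H4 : \forall k \near U, forall i, i \in iota 0 (size s) ->
      `|f k (d i) - h (d i)| < (size s).+1%:R^-1.
    apply: near_all_mem => i _.
    have s0 : 0 < (size s).+1%:R^-1 :> R by rewrite invr_gt0 ltr0n.
    by apply: filterS ((cvgrPdist_lt _ _).1 (fh (d i)) _ s0) => k;
      rewrite distrC.
  by near=> k; move=> _ ->; split; near: k.
have kmem m j : (j < m)%N -> kap j \in mkseq kap m.
  by move=> jm; apply/mapP; exists j; rewrite // mem_iota.
have {}kapQ m : [/\ forall j, (j < m)%N -> (kap j < kap m)%N,
    forall j, (j < m)%N ->
      `|f (kap m) (y (kap j)) - h (y (kap j))| <= eps / m%:R,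
    forall j, (j < m)%N -> `|f (kap j) (y (kap m))| <= eps / 2 ^+ m &
    forall i, (i < m)%N -> `|f (kap m) (d i) - h (d i)| < m.+1%:R^-1].
  have [k1 k2 k3 k4] := kapQ m m (esym (size_mkseq _ _)).
  by split=> j jm; [exact: k1 (kmem _ _ jm)|exact: k2 (kmem _ _ jm)|
    exact: k3 (kmem _ _ jm)|apply: k4; rewrite mem_iota].
have kapS k : (kap k < kap k.+1)%N by have [k1 _ _ _] := kapQ k.+1; exact: k1.
have kapge n : (n <= kap n)%N by elim: n => // n IH; exact: leq_ltn_trans IH _.
have [chi chiE] := block_subseries (fun k i => i == kap k) odd kapS.
pose H m := \sum_(0 <= j < m) h (y (kap j)) *+ odd j.
have FH m : `|f (kap m) (z chi) - (H m + f (kap m) (y (kap m)) *+ odd m)|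
    <= 3 * eps.
  have [k1 k2 k3 k4] := kapQ m.
  apply: (@row_sum_approx _ (fun j => f (kap m) (y (kap j)))) => //.
    by move=> j mj; have [_ _ + _] := kapQ j; apply.
  have [n0 _ n0P] := (cvgrPdist_lt _ _).1 (fz chi (kap m)) _ e0.
  set n := maxn n0 m.+1.
  exists n; first by rewrite leq_max leqnn orbT.
  have := n0P (kap n); rewrite /= chiE.
  have inner k : \sum_(kap k <= i < kap k.+1 | i == kap k) f (kap m) (y i) =
      f (kap m) (y (kap k)).
    rewrite big_ltn_cond ?kapS// eqxx big_nat_cond big1 ?addr0// => i.
    by move=> /andP[/andP[ki _] /eqP ik]; rewrite ik ltnn in ki.
  rewrite (eq_bigr (fun k => f (kap m) (y (kap k)) *+ odd k)); last first.
    by move=> k _; rewrite inner.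
  by apply; exact: leq_trans (leq_maxl n0 m.+1) (kapge _).
have eps0 : 0 < delta / 16 by [].
have [n [c zw]] := zd chi _ eps0.
set w := \sum_(0 <= i < n) _ in zw.
pose L := \sum_(0 <= i < n) c i * h (d i).
have fw : (fun m => f (kap m) w) @ \oo --> L.
  have -> : (fun m => f (kap m) w) =
      (fun m => \sum_(0 <= i < n) c i * f (kap m) (d i)).
    apply/funext => m; rewrite /w linear_sum; apply: eq_bigr => i _.
    by rewrite linearZ.
  apply: cvg_big => [|i _]; first exact: add_continuous.
  apply: cvgMl_tmp; apply/cvgrPdist_lt => /= t t0.
  have := near_infty_natSinv_lt (PosNum t0).
  have := nbhs_infty_gt i; apply: filterS2 => m im mt.
  have [_ _ _ k4] := kapQ m.
  by rewrite distrC (lt_trans (k4 i im)).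
have [M _ MP] := (cvgrPdist_lt _ _).1 fw _ e0.
have FL m : (M <= m)%N -> `|f (kap m) (z chi) - L| < 2 * eps.
  move=> Mm; have := fN (kap m) (z chi - w); rewrite linearB/=.
  have := MP m Mm; rewrite /= ltr_norml ler_norml ltr_norml.
  by move: zw; rewrite -/eps; lra.
(* An even index past which the values at [z chi] are [2 * eps]-close to [L]. *)
pose m := M.*2.
have Mm : (M <= m)%N by rewrite /m -addnn leq_addr.
have := FL m Mm; have := FL m.+1 (leqW Mm).
have := FH m; have := FH m.+1.
rewrite /H big_nat_recr//= /m odd_double/= mulr0n mulr1n -/m -/(H m).
have := fy (kap m.+1).
have -> : delta = 16 * eps by rewrite /eps; field.
rewrite !ler_norml !ltr_norml; lra.
Unshelve. all: by end_near. Qed.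

(** * Real and complex scalars *)

(** An alias, so that [X] can carry both module structures. *)
Definition restrict_scalars (R K : pzRingType) (emb : {rmorphism R -> K})
  (X : lmodType K) : Type := X.

Section RestrictScalars.
Variables (R K : pzRingType) (emb : {rmorphism R -> K}) (X : lmodType K).
Let E := restrict_scalars emb X.

HB.instance Definition _ := GRing.Zmodule.on E.

Let scale (a : R) (x : E) : E := emb a *: (x : X).

Let scaleA a b x : scale a (scale b x) = scale (a * b) x.
Proof. by rewrite /scale scalerA rmorphM. Qed.

Let scale1 : left_id 1 scale.
Proof. by move=> x; rewrite /scale rmorph1 scale1r. Qed.

Let scaleDr : right_distributive scale +%R.
Proof. by move=> a x y; rewrite /scale scalerDr. Qed.

Let scaleDl x : {morph scale^~ x : a b / a + b}.
Proof. by move=> a b; rewrite /scale rmorphD scalerDl. Qed.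

HB.instance Definition _ :=
  GRing.Zmodule_isLmodule.Build R E scaleA scale1 scaleDr scaleDl.

Lemma restrict_scalarsE (a : R) (x : E) : a *: x = emb a *: (x : X).
Proof. by []. Qed.

End RestrictScalars.

(** What the proof needs of a scalar field [K] over the reals: an embedding, a
    real part, and the fact that a real functional is the real part of a
    [K]-linear one, with a bound by its values at [x] and [phase *: x] (the
    phase being 1 or the imaginary unit). The field [scalar_extension] connects
    real functionals with a weak topology defined by [K]-linear ones. *)
Record real_scalars (R : realType) (K : numFieldType) := RealScalars {
  emb : {rmorphism R -> K};
  re : {additive K -> R};
  phase : K;
  le_emb : {mono emb : a b / a <= b};
  re_emb : cancel emb re;
  emb_re_norm : forall z : K, emb (re `|z|) = `|z|;
  norm_re_le : forall z : K, `|re z| <= re `|z|;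
  norm_phase : `|phase| = 1;
  scalar_extension : forall (X : lmodType K)
    (g : {scalar restrict_scalars emb X}),
    exists2 f : {scalar X}, forall x, re (f x) = g x &
      forall x, `|f x| <= emb (`|g x| + `|g (phase *: x)|)
}.

Lemma real_scalars_real (R : realType) : real_scalars R R.
Proof.
pose i : {rmorphism R -> R} := idfun.
pose r : {additive R -> R} := idfun.
apply: (@RealScalars R R i r 1) => //.
- by rewrite normr1.
- move=> X g.
  have lg : linear_for *%R (g : X -> R) by move=> a x y; exact: linearP.
  exists (HB.pack_for {scalar X} (g : X -> R)
    (GRing.isLinear.Build R X R *%R (g : X -> R) lg)) => x //=.
  by rewrite /i/= lerDl.
Qed.

(** The complexification of g is g(x) - i g(i x). *)
Lemma real_scalars_complex (R : realType) : real_scalars R R[i]%C.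
Proof.
pose i : {rmorphism R -> R[i]%C} := real_complex R.
have reB : zmod_morphism (@complex.Re R) by case=> [a b] [c d].
pose r : {additive R[i]%C -> R} := HB.pack_for {additive R[i]%C -> R}
  (@complex.Re R) (GRing.isZmodMorphism.Build _ _ _ reB).
apply: (@RealScalars R R[i]%C i r 'i%C) => //.
- by move=> a b; exact: lecR.
- move=> z; have := normc_ge_Re z.
  by rewrite -[X in _ <= X](RRe_real (normr_real z)) lecR.
- by rewrite normc_def /= expr0n add0r expr1n sqrtr1.
- move=> X g.
  pose f (x : X) : R[i]%C := (g x +i* - g ('i%C *: x))%C.
  have gD (x y : X) : g (x + y) = g x + g y by exact: raddfD.
  have gZ a (x : X) : g (a%:C%C *: x) = a * g x by exact: (scalarZ g a x).
  have gC a b x : g ((a +i* b)%C *: x) = a * g x + b * g ('i%C *: x).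
    have -> : (a +i* b)%C = a%:C%C + b%:C%C * 'i%C by simpc.
    by rewrite scalerDl gD -scalerA !gZ.
  have lf : linear_for *%R f.
    move=> [a b] x y; rewrite /f scalerDr scalerA !gD (gC a b).
    have -> : ('i * (a +i* b))%C = (- b +i* a)%C by simpc.
    rewrite (gC (- b) a); apply/eqP; rewrite eq_complex /=.
    by apply/andP; split; apply/eqP; ring.
  exists (HB.pack_for {scalar X} f
    (GRing.isLinear.Build _ X _ *%R f lf)) => x //=.
  rewrite normc_def lecR /= sqrrN -ler_sqr ?nnegrE ?addr_ge0 ?sqrtr_ge0//.
  rewrite sqr_sqrtr ?addr_ge0 ?sqr_ge0// sqrrD !real_normK ?num_real//.
  by rewrite addrAC lerDl mulrn_wge0// mulr_ge0.
Qed.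

(** * Norming functionals *)

Section RealNorm.
Variables (R : realType) (K : numFieldType) (rs : real_scalars R K).
Variable X : normedModType K.
Let E := restrict_scalars (emb rs) X.

(** The norm of [X] takes its values in [K]; here it is real-valued. *)
Definition real_norm (x : X) : R := re rs `|x|.
Local Notation N := real_norm.

Lemma emb_real_norm x : emb rs (N x) = `|x|.
Proof. by have := emb_re_norm rs `|x|; rewrite normr_id. Qed.

Lemma lt_emb : {mono emb rs : a b / a < b}.
Proof. exact: leW_mono (le_emb rs). Qed.

Lemma emb_ge0 a : (0 <= emb rs a) = (0 <= a).
Proof. by rewrite -(rmorph0 (emb rs)) le_emb. Qed.

Lemma emb_gt0 a : (0 < emb rs a) = (0 < a).
Proof. by rewrite -(rmorph0 (emb rs)) lt_emb. Qed.

Lemma norm_emb a : `|emb rs a| = emb rs `|a|.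
Proof.
have [a0|/ltW a0] := leP 0 a; first by rewrite !ger0_norm ?emb_ge0.
by rewrite !ler0_norm ?rmorphN// -oppr_ge0 -rmorphN emb_ge0 oppr_ge0.
Qed.

Lemma real_norm_ge0 x : 0 <= N x.
Proof. by rewrite -emb_ge0 emb_real_norm. Qed.

Lemma real_normD x y : N (x + y) <= N x + N y.
Proof. by rewrite -(le_emb rs) rmorphD !emb_real_norm ler_normD. Qed.

Lemma real_normN x : N (- x) = N x.
Proof. by rewrite /N normrN. Qed.

Lemma real_normZ a x : N (emb rs a *: x) = `|a| * N x.
Proof.
apply: (inc_inj (le_emb rs)).
by rewrite rmorphM !emb_real_norm normrZ norm_emb.
Qed.

(** Separation of [y] from the sum of [V] and the closed ball of radius [r],
    rescaled by [r]. Three choices of [V] matter: a convex neighbourhood of 0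
    for tau (which makes [g] tau-continuous), the singleton 0 (a norming
    functional), and a subspace (on which [g] vanishes). *)
Lemma norming_functional (V : set E) (y : E) (r : R) : 0 < r -> V 0 ->
  (forall u v a b, 0 <= a -> 0 <= b -> a + b = 1 ->
    V u -> V v -> V (a *: u + b *: v)) ->
  (forall v, V v -> r < N (y - v)) ->
  exists g : {scalar E}, [/\ forall x, `|g x| <= N x, r <= g y &
    forall v, V v -> g v <= r].
Proof.
move=> r0 V0 Vc Vy.
pose C : set E := [set x : E | exists2 v : E, V v & N (x - v) <= r].
have CN x : N x <= r -> C x by move=> xr; exists 0; rewrite ?subr0.
have [| | |f [fC fy]] := @convex_separation R E C y.
- move=> u u' a b a0 b0 ab [v Vv uv] [v' Vv' uv'].
  exists (a *: v + b *: v'); first exact: Vc.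
  have -> : a *: u + b *: u' - (a *: v + b *: v') =
      emb rs a *: (u - v : X) + emb rs b *: (u' - v' : X).
    by rewrite !scalerBr opprD addrACA.
  apply: le_trans (real_normD _ _) _.
  rewrite !real_normZ !ger0_norm// -[leRHS]mul1r -ab mulrDl.
  by rewrite lerD// ler_wpM2l.
- move=> x; have Nx1 : 0 < N x + 1 by rewrite ltr_wpDl ?real_norm_ge0.
  exists (r / (N x + 1)); first exact: divr_gt0.
  apply: CN; rewrite [_ *: _]restrict_scalarsE real_normZ ger0_norm; last first.
    by rewrite divr_ge0 ?ltW.
  by rewrite -mulrA ger_pMr// ler_pdivrMl// mulr1 lerDl.
- by move=> [v Vv]; rewrite leNgt Vy.
have fN x : r * f x <= N x.
  rewrite leNgt; apply/negP => xf.
  (* Scaling [x] to norm just below [r] would give [f] a value above 1. *)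
  pose s := (N x + r * f x) / 2.
  have s0 : 0 < s by have := real_norm_ge0 x; rewrite /s; lra.
  have xs : N x < s by rewrite /s; lra.
  have sf : s < r * f x by rewrite /s; lra.
  have /fC : C ((r / s) *: x).
    apply: CN; rewrite [_ *: _]restrict_scalarsE real_normZ ger0_norm; last first.
      by rewrite divr_ge0 ?ltW.
    by rewrite -mulrA ger_pMr// ler_pdivrMl// mulr1 ltW.
  rewrite scalarZ mulrAC ler_pdivrMr// mul1r; lra.
have lg : linear_for *%R (fun x => r * f x).
  by move=> a x z; rewrite linearP/= mulrDr mulrCA.
exists (HB.pack_for {scalar E} (fun x => r * f x)
  (GRing.isLinear.Build R E R *%R (fun x => r * f x) lg)); split=> /=.
- move=> x; rewrite ler_norml fN andbT lerNl.
  by have := fN (- x); rewrite raddfN mulrN real_normN.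
- by rewrite ler_peMr// ltW.
- move=> v Vv; rewrite ger_pMr//; apply: fC.
  by exists v; rewrite // subrr /real_norm normr0 raddf0 ltW.
Qed.

Definition real_span (d : nat -> E) : set E :=
  [set w | exists n (c : nat -> R), w = \sum_(0 <= i < n) c i *: d i].

Lemma real_span_comb d u v a b : real_span d u -> real_span d v ->
  real_span d (a *: u + b *: v).
Proof.
have pad n m (c : nat -> R) : (n <= m)%N ->
    \sum_(0 <= i < n) c i *: d i = \sum_(0 <= i < m) (c i *+ (i < n)%N) *: d i.
  move=> nm; rewrite (big_nat_widen _ _ _ _ _ nm) big_mkcond/=.
  by apply: eq_bigr => i _; case: (i < n)%N; rewrite ?scale0r.
move=> [n [c ->]] [m [c' ->]].
rewrite (pad n (maxn n m)) ?leq_maxl// (pad m (maxn n m)) ?leq_maxr//.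
exists (maxn n m).
exists (fun i => a * (c i *+ (i < n)%N) + b * (c' i *+ (i < m)%N)).
rewrite !scaler_sumr -big_split; apply: eq_bigr => i _ /=.
by rewrite scalerDl !scalerA.
Qed.

End RealNorm.

Lemma affine_continuous (K : numFieldType) (E : preTopologicalLmodType K)
    (c : K) (w : E) :
  continuous (fun z : E * E => z.1 + z.2) ->
  continuous (fun z : K^o * E => z.1 *: z.2) ->
  continuous (fun v : E => c *: v + w).
Proof.
move=> addc scalec v.
apply: (@continuous2_cvg _ _ _ _ (nbhs v) _ (fun v : E => c *: v) (fun=> w)
  +%R (c *: v) w); [exact: (addc (c *: v, w))| |exact: cvg_cst].
apply: (@continuous2_cvg _ _ _ _ (nbhs v) _ (fun=> c : K^o) id
  (fun k x => k *: x) (c : K^o) v); [exact: (scalec (c, v))| |exact: cvg_id].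
exact: (cvg_cst (c : K^o)).
Qed.

(** A norm-continuous functional is weakly continuous, hence continuous for any
    topology refining the weak one. *)
Lemma weakly_open_continuous (K : numFieldType) (X : normedModType K)
    (tau : topology_on X) (f : {scalar X}) :
  (forall U : set X, open (U : set (weak_topology X)) ->
    open (U : set (with_topology tau))) ->
  continuous (f : X -> K) -> continuous (f : with_topology tau -> K).
Proof.
move=> wtau cf z A.
have fw : continuous (f : weak_topology X -> K).
  move=> v.
  pose F : {f : {scalar X} | continuous (f : X -> K)} := exist _ f cf.
  have wi : nbhs (v : weak_topology X) -->
      (v : initial_topology (sval F : X -> K)).
    have FF := nbhs_filter (v : weak_topology X).
    pose Tc (f : {f : {scalar X} | continuous (f : X -> K)}) :=
      Topological.on (initial_topology (sval f : X -> K)).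
    have [h _] := cvg_sup Tc v FF.
    exact: (h (fun B => id) F).
  move=> B Bv; apply: wi.
  exact: (initial_continuous (f := sval F : X -> K) (x := v)).
rewrite nbhsE => -[U [Uo Uz] UA].
have fU : open (f @^-1` U : set (weak_topology X)).
  by apply: open_comp => // x _; exact: fw.
rewrite nbhsE; exists (f @^-1` U); last exact: preimage_subset.
by split=> //; exact: wtau.
Qed.

(** * Sequential continuity for an admissible topology *)

Definition seq_continuous (K : numFieldType) (X : lmodType K)
    (tau : topology_on X) (R : realType) (g : X -> R) :=
  forall (u : nat -> with_topology tau) (z : with_topology tau),
    u @ \oo --> z -> (g \o u) @ \oo --> g z.

Section Norming.
Variables (R : realType) (K : numFieldType) (rs : real_scalars R K).
Variables (X : normedModType K) (tau : topology_on X).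
Let E := restrict_scalars (emb rs) X.
Local Notation N := (real_norm rs).

(** The set of [v] with [y - v] outside the closed ball of radius [r] is a
    tau-neighbourhood of 0, hence contains a convex one, [V]; a functional that
    is bounded above on [V] is tau-continuous. *)
Lemma norming_functional_closed_ball (y : X) (r : R) :
  hausdorff_lctvs (with_topology tau) ->
  closed ([set x : X | `|x| <= 1] : set (with_topology tau)) ->
  0 < r -> r < N y ->
  exists g : {scalar E},
    [/\ forall x, `|g x| <= N x, r <= g y & seq_continuous tau g].
Proof.
move=> [_ addc scalec [B Bconv [Bo Bb]]] clB r0 ry.
have aff c w := @affine_continuous K (with_topology tau) c w addc scalec.
pose W : set (with_topology tau) := [set v : X | r < N (y - v)].
have oW : open W.
  (* The scaling by the inverse of [r] turns the ball of radius [r] into the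
     unit ball. *)
  pose h (v : with_topology tau) : with_topology tau :=
    emb rs (- r^-1) *: v + emb rs r^-1 *: (y : with_topology tau).
  have hE v : (`|h v : X| <= 1) = (N (y - v) <= r).
    have -> : (h v : X) = emb rs r^-1 *: (y - v).
      by rewrite /h rmorphN scaleNr addrC -scalerBr.
    rewrite -(emb_real_norm rs) -(rmorph1 (emb rs)) le_emb real_normZ.
    by rewrite gtr0_norm ?invr_gt0// ler_pdivrMl// mulr1.
  have -> : W = h @^-1` (~` [set x : X | `|x| <= 1]).
    by apply/seteqP; split=> v; rewrite /W /= hE ltNge => /negP.
  apply: open_comp; last exact: closed_openC.
  by move=> v _; exact: aff.
have /Bb[V [BV V0] VW] : nbhs (0 : with_topology tau) W.
  by apply: open_nbhs_nbhs; split=> //; rewrite /W /= subr0.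
have nV := Bo _ BV.
have [| |g [gN gy gV]] := @norming_functional R K rs X V y r r0 V0.
- move=> v v' a b a0 b0 ab Vv Vv'.
  have ea0 : 0 <= emb rs a by rewrite emb_ge0.
  have ea1 : emb rs a <= 1 by rewrite -(rmorph1 (emb rs)) le_emb; lra.
  have := Bconv V (mem_set BV) v v' (Itv01 ea0 ea1) (mem_set Vv) (mem_set Vv').
  rewrite inE !restrict_scalarsE.
  suff -> : emb rs b = 1 - emb rs a by [].
  by rewrite -(rmorph1 (emb rs)) -ab rmorphD addrAC subrr add0r.
- by move=> v /VW.
exists g; split=> // u z uz.
apply/cvgrPdist_lt => e e0.
(* [V] is not assumed symmetric, hence the two scalings [t] and [- t]. *)
pose t := 2 * r / e; have t0 : 0 < t by rewrite divr_gt0 ?mulr_gt0.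
have near0 (s : R) : \forall n \near \oo, V (s *: (u n - z : E)).
  have := cvg_comp _ _ uz (aff (emb rs s) (- (emb rs s *: z)) z).
  rewrite subrr => /(_ V (open_nbhs_nbhs (conj nV V0))) h.
  have {}h : \forall n \near \oo, V (emb rs s *: u n - emb rs s *: z) := h.
  by apply: filterS h => n; rewrite -scalerBr.
have te : t * e = 2 * r by rewrite /t divfK// lt0r_neq0.
have h1 := near0 t; have h2 := near0 (- t).
apply: filterS2 h1 h2 => n /gV + /gV.
rewrite !scalarZ linearB/= mulNr => h1 h2.
rewrite ltr_norml -(ltr_pM2l t0) -[X in _ && X](ltr_pM2l t0) mulrN te; lra.
Qed.

Lemma bounded_seq_continuous (g : {scalar E}) :
  (forall U : set X, open (U : set (weak_topology X)) ->
    open (U : set (with_topology tau))) ->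
  (forall x, `|g x| <= N x) -> seq_continuous tau g.
Proof.
move=> wtau gN.
have [f fg fN] := scalar_extension g.
have cf : continuous (f : X -> K).
  have fX x : `|f x| <= 2 * `|x|.
    apply: le_trans (fN x) _; rewrite mulr_natl mulr2n.
    rewrite -(emb_real_norm rs) -rmorphD le_emb.
    apply: lerD => //; apply: le_trans (gN _) _.
    by rewrite /real_norm normrZ norm_phase mul1r.
  move=> v; apply/cvgrPdist_lt => e e0.
  have e2 : 0 < e / 2 by rewrite divr_gt0.
  apply: filterS ((cvgrPdist_lt _ _).1 (@cvg_id _ (nbhs v)) _ e2) => w vw.
  rewrite -linearB; apply: le_lt_trans (fX _) _.
  by rewrite -ltr_pdivlMl// mulrC.
have cft := weakly_open_continuous wtau cf.
move=> u z uz.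
have fuz : (fun n => f (u n)) @ \oo --> f z.
  by apply: (cvg_comp _ _ uz); exact: cft.
apply/cvgrPdist_lt => e e0.
have ee0 : 0 < emb rs e by rewrite emb_gt0.
apply: filterS ((cvgrPdist_lt _ _).1 fuz _ ee0) => n.
rewrite /= -(emb_re_norm rs) lt_emb; apply: le_lt_trans.
by have := norm_re_le rs (f z - f (u n)); rewrite raddfB/= !fg.
Qed.

End Norming.

(** * The Orlicz-Pettis theorem for admissible topologies *)

(** If a rearrangement by [s] is not Cauchy, it has far-out segments of large
    sum; far enough, [s] sends such a segment beyond any given [M]. *)
Lemma not_unconditional_blocks (K : numFieldType) (X : completeNormedModType K)
    (x : X ^nat) : ~ unconditionally_summable x ->
  exists2 delta : K, 0 < delta & forall M, exists M' (P : nat -> bool),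
    (M < M')%N /\ delta <= `|\sum_(M <= i < M' | P i) x i|.
Proof.
move=> /existsNP[s /not_implyP[[t st ts] ncv]].
have : ~ cauchy (series (x \o s) @ \oo) by move=> /cauchy_cvgP.
move=> /cauchy_seriesP/existsNP[delta /not_implyP[d0 dP]].
exists delta => // M; apply: contrapT => nblock; apply: dP.
(* From rank [m0] on, [s] takes no value below [M]: [t] inverts [s]. *)
pose m0 := \max_(j < M) (t j).+1.
have sM i : (m0 <= i)%N -> (M <= s i)%N.
  rewrite leqNgt => mi; rewrite leqNgt; apply: contra mi => siM.
  have := leq_bigmax (F := fun j : 'I_M => (t j).+1) (Ordinal siM).
  by rewrite /= st.
have small m n : (m0 <= m)%N ->
    `|\sum_(m <= k < n) (x \o s) k| < delta.
  move=> m0m; apply: contrapT => /negP.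
  rewrite -real_leNgt ?(gtr0_real d0) ?normr_real//.
    move=> big; apply: nblock.
    pose A := [seq s k | k <- index_iota m n].
    exists (M + (\max_(i <- A) i)).+1, (mem A).
    split; first by rewrite ltnS leq_addr.
    rewrite [X in `|X|](_ : _ = \sum_(m <= k < n) (x \o s) k)//.
    rewrite -[RHS](big_map s xpredT x) -[LHS]big_filter.
    apply: perm_big; apply: uniq_perm.
    - exact/filter_uniq/iota_uniq.
    - by rewrite map_inj_uniq ?iota_uniq//; exact: can_inj st.
    - move=> i; rewrite mem_filter andb_idr// => iA; rewrite mem_index_iota.
      have [k + ik] := mapP iA; rewrite mem_index_iota => /andP[mk _].
      rewrite ik sM ?(leq_trans m0m)//= ltnS -ik.
      by rewrite (leq_trans _ (leq_addl _ _))// (@leq_bigmax_seq _ A xpredT id).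
near=> n; apply: small; near: n.
exact: (@cvg_fst _ _ \oo \oo _ _ (nbhs_infty_ge m0)).
Unshelve. all: by end_near. Qed.

Lemma separable_dense_seq (K : numFieldType) (X : normedModType K) :
  separable X ->
  exists d : nat -> X, forall z (e : K), 0 < e -> exists i, `|z - d i| < e.
Proof.
move=> [D /countable_injP[c cinj] Dd].
exists (fun i => xget 0 [set v | D v /\ c v = i]) => z e e0.
have [v [zv Dv]] := Dd (ball z e) (ex_intro _ z (ballxx z e0)) (ball_open z e).
exists (c v); case: xgetP => [w _ [Dw cw]|/(_ v) []//].
rewrite (cinj _ _ (mem_set Dw) (mem_set Dv) cw).
by move: zv; rewrite -ball_normE.
Qed.

(** The partial sums of the blocks are a subsequence of the partial sums of the
    selected series, so they have the same tau-limit. *)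
Lemma subseries_functional (R : realType) (K : numFieldType)
    (rs : real_scalars R K) (X : lmodType K) (tau : topology_on X)
    (x y : nat -> X) (b : nat -> nat) (chi e : nat -> bool)
    (z : with_topology tau) (g : {scalar restrict_scalars (emb rs) X}) :
  (forall k, b k < b k.+1)%N ->
  (forall M, \sum_(0 <= i < b M) x i *+ chi i =
             \sum_(0 <= k < M) y k *+ e k) ->
  (fun n => \sum_(0 <= i < n.+1) x i *+ chi i : with_topology tau) @ \oo --> z ->
  seq_continuous tau g ->
  (fun n => \sum_(0 <= j < n) g (y j) *+ e j) @ \oo --> g z.
Proof.
move=> bS chiE xz gc.
have bge n : (n <= b n)%N by elim: n => // n IH; exact: leq_ltn_trans IH _.
have bcv : (fun n => (b n.+1).-1) @ \oo --> \oo.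
  move=> A [n0 _ n0A]; exists n0 => // n /= n0n; apply: n0A => /=.
  by rewrite -ltnS prednK ?(leq_trans _ (bge _))// (leq_trans n0n).
have gE : (fun n => \sum_(0 <= j < n.+1) g (y j) *+ e j) =
    (fun n => g (\sum_(0 <= i < (b n.+1).-1.+1) x i *+ chi i)).
  apply/funext => n; rewrite prednK ?(leq_trans _ (bge _))// chiE linear_sum.
  by apply: eq_bigr => i _; rewrite raddfMn.
rewrite -cvg_shiftS /= gE.
exact: gc _ _ (cvg_comp _ _ bcv xz).
Qed.

(** The two clauses of admissibility feed [gliding_hump] differently. For
    separable [X] a dense sequence serves as [d], and the norming functionals
    have to be built from tau. Otherwise any norming functional is sequentially
    tau-continuous, and the work is to see that [y] itself can serve as [d]. *)
Theorem orlicz_pettis (R : realType) (K : numFieldType)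
    (rs : real_scalars R K) (X : completeNormedModType K) (tau : topology_on X)
    (x : X ^nat) : admissible tau ->
  (forall chi : nat -> bool, exists l : with_topology tau,
    (fun n => \sum_(0 <= i < n.+1) x i *+ chi i : with_topology tau) @ \oo --> l) ->
  unconditionally_summable x.
Proof.
move=> [lctvs _ clB wtau] xcv; apply: contrapT => nus.
have [delta d0 block] := not_unconditional_blocks nus.
have [next /choice[P nextP]] := choice block.
pose b k := iter k next 0.
have bS k : (b k < b k.+1)%N by have [] := nextP (b k).
pose y k := \sum_(b k <= i < b k.+1 | P (b k) i) x i.
have yd k : re rs delta <= real_norm rs (y k).
  rewrite -(le_emb rs) emb_real_norm -(gtr0_norm d0) emb_re_norm gtr0_norm//.
  by have [] := nextP (b k).
have red0 : 0 < re rs delta.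
  by rewrite -(emb_gt0 rs) -(gtr0_norm d0) emb_re_norm gtr0_norm.
pose r := re rs delta / 2.
have r0 : 0 < r by rewrite divr_gt0.
have ry k : r < real_norm rs (y k).
  by apply: lt_le_trans (yd k); rewrite /r; lra.
have zE (e : nat -> bool) : exists z : X,
    forall g : {scalar restrict_scalars (emb rs) X}, seq_continuous tau g ->
      (fun n => \sum_(0 <= j < n) g (y j) *+ e j) @ \oo --> g z.
  have [chi chiE] := block_subseries (fun k => P (b k)) e bS.
  have [z xz] := xcv chi.
  by exists z => g; apply: (subseries_functional bS (chiE X x) xz).
have [z zP] := choice zE.
suff [d [dz normg]] : exists d : nat -> restrict_scalars (emb rs) X,
    (forall e eta, 0 < eta -> exists2 w, real_span d w &
      real_norm rs (z e - w) < eta) /\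
    forall k, exists g : {scalar restrict_scalars (emb rs) X},
      [/\ forall v, `|g v| <= real_norm rs v, r <= g (y k) &
          seq_continuous tau g].
  have [g gP] := choice normg.
  apply: (@gliding_hump R (restrict_scalars (emb rs) X) (@real_norm R K rs X)
    g d y z r) => //.
  - by move=> k v; have [+ _ _] := gP k; apply.
  - by move=> e k; apply: zP; have [] := gP k.
  - move=> e eta eta0; have [_ [n [c ->]] h] := dz e eta eta0.
    by exists n, c.
  - by move=> k; have [] := gP k.
have [sepX|nsepX] := EM (separable X).
  have [d dP] := separable_dense_seq sepX.
  exists d; split=> [e eta eta0|k].
    have [|i zd] := dP (z e) (emb rs eta); first by rewrite emb_gt0.
    exists (d i); last by rewrite -(lt_emb rs) emb_real_norm.
    exists i.+1, (fun j => (j == i)%:R).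
    rewrite big_nat_recr//= eqxx scale1r big_nat big1 ?add0r// => j /= ji.
    by rewrite ltn_eqF// scale0r.
  exact: norming_functional_closed_ball.
have {}wtau := wtau nsepX.
exists y; split=> [e eta eta0|k].
  (* A functional vanishing on the span of [y] vanishes on the partial sums,
     hence at their limit [z e]. *)
  apply: contrapT => far.
  have eta2 : 0 < eta / 2 by rewrite divr_gt0.
  have [||v yv|g [gN gz gV]] :=
    @norming_functional R K rs X (real_span y) (z e) (eta / 2) eta2.
  - by exists 0, (fun=> 0); rewrite big_geq.
  - by move=> *; exact: real_span_comb.
  - have : eta <= real_norm rs (z e - v).
      by rewrite leNgt; apply/negP => zv; apply: far; exists v.
    by apply: lt_le_trans; lra.
  have g0 v : real_span y v -> g v <= 0.
    move=> yv; rewrite leNgt; apply/negP => gv0.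
    have := gV _ (real_span_comb (eta / g v) 0 yv yv).
    by rewrite scale0r addr0 scalarZ divfK ?lt0r_neq0//; lra.
  have gy j : g (y j) = 0.
    have span a : real_span y (a *: (y j : restrict_scalars (emb rs) X)).
      exists j.+1, (fun i => a *+ (i == j)).
      rewrite big_nat_recr//= eqxx big_nat big1 ?add0r// => i /= ij.
      by rewrite ltn_eqF// scale0r.
    have := g0 _ (span 1); have := g0 _ (span (-1)).
    by rewrite !scalarZ; lra.
  have gc := bounded_seq_continuous wtau gN.
  suff gz0 : g (z e) = 0 by rewrite gz0 leNgt eta2 in gz.
  rewrite -(cvg_lim (@Rhausdorff R) (zP e g gc)).
  rewrite (_ : (fun n => _) = fun=> 0); first exact: lim_cst.
  by apply/funext => n; rewrite big1// => j _; rewrite gy mul0rn.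
have [| | |g [gN gy gV]] := @norming_functional R K rs X [set 0] (y k) r r0.
- by [].
- by move=> u v a c _ _ _ -> ->; rewrite !scaler0 addr0.
- by move=> _ ->; rewrite subr0.
- by exists g; split=> //; exact: bounded_seq_continuous.
Qed.

Theorem theorem1p1 (R : realType) (K : numFieldType)
    (hK : K = R :> numFieldType \/ K = R[i]%C :> numFieldType)
    (X : completeNormedModType K) (tau : topology_on X)
    (htau : admissible tau) (x : X ^nat) :
  let i := exists2 eps : nat -> K, (forall n, eps n = -1 \/ eps n = 1) &
    forall l : with_topology tau,
      ~ ((fun N => \sum_(0 <= n < N.+1) eps n *: x n : with_topology tau)
           @ \oo --> l) in
  let ii := exists2 chi : nat -> K, (forall n, chi n = 0 \/ chi n = 1) &
    forall l : with_topology tau,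
      ~ ((fun N => \sum_(0 <= n < N.+1) chi n *: x n : with_topology tau)
           @ \oo --> l) in
  (~ unconditionally_summable x -> i /\ ii) /\ (~ cvgn (series x) -> i /\ ii).
Proof.
move=> i ii.
have [rs] : inhabited (real_scalars R K).
  case: hK => ->; constructor.
    exact: real_scalars_real.
  exact: real_scalars_complex.
suff main : ~ unconditionally_summable x -> i /\ ii.
  by split=> // ncv; apply: main => h; apply/ncv/(h id); exists id.
move=> nus; split; apply: contrapT => noseq; apply: nus.
- apply: (orlicz_pettis rs htau) => chi.
  have signs (e : nat -> K) : (forall n, e n = -1 \/ e n = 1) ->
      exists l : with_topology tau,
        (fun N => \sum_(0 <= n < N.+1) e n *: x n : with_topology tau)
          @ \oo --> l.
    move=> e1; apply: contrapT => /forallNP nl; apply: noseq.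
    by exists e.
  pose e n : K := (-1) ^+ (~~ chi n).
  have e1 n : e n = -1 \/ e n = 1 by rewrite /e; case: (chi n); [right|left].
  have [l el] := signs e e1.
  have [l1 e1l] := signs (fun=> 1) (fun=> or_intror erefl).
  have [[_ addc scalec _] _ _ _] := htau.
  have half :=
    @affine_continuous K (with_topology tau) 2^-1 0 addc scalec (l + l1).
  have sum := continuous2_cvg eventually_filter (addc (l, l1)) el e1l.
  have := cvg_comp _ _ sum half; rewrite addr0 => h.
  exists (2^-1 *: (l + l1)); apply: cvg_trans h; apply: near_eq_cvg.
  apply: nearW => n /=; rewrite addr0 -big_split scaler_sumr.
  apply: eq_bigr => k _ /=; rewrite -scalerDl scalerA /e.
  case: (chi k); rewrite /= ?addNr ?mulr0 ?scale0r//.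
  by rewrite -mulr2n mulVf ?scale1r ?pnatr_eq0.
- apply: (orlicz_pettis rs htau) => chi.
  apply: contrapT => /forallNP nl; apply: noseq.
  exists (fun n => (chi n)%:R); first by move=> n; case: (chi n); [right|left].
  move=> l; have := nl l.
  by under eq_fun do under eq_bigr do rewrite -scaler_nat.
Qed.
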